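(* Every $\delta$-clean ring is $\delta$-reversible.
   Context: All rings are associative with identity. A submodule $N$ of a right module $M$ is $\delta$-small in $M$ if whenever $M=N+L$ with $M/L$ singular, then $M=L$. The Zhou radical $\delta(R)$ is the sum of all $\delta$-small right ideals of $R$; equivalently, $\delta(R)$ is the intersection of all essential maximal right ideals of $R$ (with $\delta(R)=R$ if there are none). It is a two-sided ideal of $R$. A ring $R$ is $\delta$-reversible if for all $a,b\in R$, $ab=0$ implies $ba\in\delta(R)$. A ring $R$ is $\delta$-clean if for every $a\in R$ there exist an idempotent $e\in R$ and an element $d\in\delta(R)$ such that $a=e+d$. *)

(* Defs.v *)
From HB Require Import structures.
From mathcomp Require Import all_boot all_algebra.
From mathcomp Require Import boolp classical_sets.

Set Implicit Arguments.
Unset Strict Implicit.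
Unset Printing Implicit Defensive.

Import GRing.Theory.
Local Open Scope classical_set_scope.
Local Open Scope ring_scope.

(* A right R-module is a left module over the converse ring R^c, so that       *)
(* [r *: m] below stands for m r.  Rings are [pzRingType]s: the zero ring is   *)
(* not excluded.                                                               *)
Section RightModules.
Variables (R : pzRingType) (M : lmodType R^c).

Definition submodule (N : set M) : Prop := GRing.submod_closed (mem N).

Definition essential (N : set M) : Prop :=
  submodule N /\
  forall K : set M, submodule K -> K != [set 0] -> N `&` K != [set 0].

Definition addsub (N L : set M) : set M := [set n + l | n in N & l in L].

Definition sumsub (F : set (set M)) : set M :=
  [set x | exists (n : nat) (N : 'I_n -> set M) (u : 'I_n -> M),
     (forall i, F (N i) /\ N i (u i)) /\ x = \sum_(i < n) u i].

End RightModules.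

(* As a left module over R^c, the ring (R^c)^o is R acting on itself by right  *)
(* multiplication: r *: x = x * r, the latter product being that of R.         *)
Definition regular_module (R : pzRingType) : lmodType R^c := (R^c)^o.

Lemma regular_moduleE (R : pzRingType) (r x : R) :
  (r : R^c) *: (x : regular_module R) = x * r.
Proof. by []. Qed.

Section Singular.
Variables (R : pzRingType) (M : lmodType R^c).

Definition ann (m : M) : set (regular_module R) :=
  [set r | (r : R^c) *: m = 0].

Definition singular : Prop := forall m : M, essential (ann m).

(* The annihilator of the coset m + L in M / L is {r | m r \in L}.             *)
Definition ann_coset (L : set M) (m : M) : set (regular_module R) :=
  [set r | L ((r : R^c) *: m)].

(* M / L is singular; see [singular_quotientP].                                *)
Definition singular_quotient (L : set M) : Prop :=
  forall m : M, essential (ann_coset L m).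

Definition delta_small (N : set M) : Prop :=
  submodule N /\
  forall L : set M, submodule L -> singular_quotient L ->
    addsub N L = setT -> L = setT.

End Singular.

Lemma singular_quotientP (R : pzRingType) (M Q : lmodType R^c) (L : set M)
    (p : {linear M -> Q}) :
  (forall y, exists x, p x = y) -> (forall x, p x = 0 <-> L x) ->
  singular Q <-> singular_quotient L.
Proof.
move=> p_surj ker_p.
have annE m : ann (p m) = ann_coset L m.
  by apply/seteqP; split=> r; rewrite /ann /ann_coset /= -linearZ; apply ker_p.
split=> sing m; first by rewrite -annE; apply: sing.
by have [x <-] := p_surj m; rewrite annE; apply: sing.
Qed.

Section DeltaRings.
Variable R : pzRingType.

Definition zhou_radical : set R :=
  sumsub [set I : set (regular_module R) | delta_small I].

Definition delta_reversible : Prop :=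
  forall a b : R, a * b = 0 -> zhou_radical (b * a).

Definition delta_clean : Prop :=
  forall a : R, exists e d : R, [/\ e * e = e, zhou_radical d & a = e + d].

End DeltaRings.

(* Main.v *)
Require Import Defs.
From mathcomp Require Import all_boot all_algebra.
From HB Require Import structures.
From mathcomp Require Import classical_sets.

(** Modulo the two-sided ideal [zhou_radical R], every element of a delta-clean
    ring is idempotent.  Subtracting the relations [a^2 = a] and [b^2 = b] from
    [(a + b)^2 = a + b] leaves [ab + ba = 0], which is [ba = 0] as soon as
    [ab = 0].  The radical is stable under left multiplication because
    homomorphic images of delta-small submodules are delta-small. *)

Set Implicit Arguments.
Unset Strict Implicit.
Unset Printing Implicit Defensive.

Import GRing.Theory.
Local Open Scope classical_set_scope.
Local Open Scope ring_scope.

(** Trades the boolean membership of [submod_closed] for direct application of [N] as a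
    predicate. *)
Lemma submoduleP (R : pzRingType) (M : lmodType R^c) (N : set M) :
  submodule N <->
  N 0 /\ forall (r : R^c) x y, N x -> N y -> N (r *: x + y).
Proof.
split=> [[N0 Nlin]|[N0 Nlin]].
  split; first by move: N0; rewrite !inE.
  by move=> r x y Nx Ny; have := Nlin r x y; rewrite !inE; apply.
by split=> [|r x y]; rewrite !inE //; apply: Nlin.
Qed.

Lemma submodule_scale (R : pzRingType) (M : lmodType R^c) (N : set M)
    (r : R^c) x : submodule N -> N x -> N (r *: x).
Proof. by move=> /submoduleP[N0 Nlin] Nx; rewrite -[_ *: _]addr0; apply: Nlin. Qed.

Section Image.
Variables (R : pzRingType) (M M' : lmodType R^c) (f : {linear M -> M'}).

Lemma submodule_image (N : set M) : submodule N -> submodule (f @` N).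
Proof.
move=> /submoduleP[N0 Nlin]; apply/submoduleP; split.
  by exists 0 => //; rewrite linear0.
move=> r _ _ [x Nx <-] [y Ny <-].
by exists (r *: x + y); [apply: Nlin | rewrite linearP].
Qed.

Lemma submodule_preimage (L : set M') : submodule L -> submodule (f @^-1` L).
Proof.
move=> /submoduleP[L0 Llin]; apply/submoduleP; split; first by rewrite /= linear0.
by move=> r x y Lx Ly; rewrite /= linearP; apply: Llin.
Qed.

(** [f] induces an injection of M / f^-1(L) into M' / L, so the cosets of [m] and [f m] have the
    same annihilator. *)
Lemma singular_quotient_preimage (L : set M') :
  singular_quotient L -> singular_quotient (f @^-1` L).
Proof.
move=> sing m; suff -> : ann_coset (f @^-1` L) m = ann_coset L (f m) by apply: sing.
by apply/seteqP; split=> r; rewrite /ann_coset /= linearZ.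
Qed.

(** If f(N) + L = M', then N + f^-1(L) = M, and smallness of [N] forces f^-1(L) = M. Hence f(N) lies
    in [L], and [L] is all of M'. *)
Lemma delta_small_image (N : set M) : delta_small N -> delta_small (f @` N).
Proof.
move=> [subN smallN]; split=> [|L subL singL sumL]; first exact: submodule_image.
have preL : f @^-1` L = setT.
  apply: smallN; [exact: submodule_preimage|exact: singular_quotient_preimage|].
  apply/seteqP; split=> // m _.
  have [_ [n Nn <-] [l Ll fm]] : addsub (f @` N) L (f m) by rewrite sumL.
  (* Since f m = f n + l, the difference [m - n] is mapped to [l], which is in [L]. *)
  exists n => //; exists (m - n); last by rewrite addrC subrK.
  by rewrite /= linearB -fm addrC addKr.
apply/seteqP; split=> // y _.
have [_ [n Nn <-] [l Ll <-]] : addsub (f @` N) L y by rewrite sumL.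
have Lfn : L (f n) by have : (f @^-1` L) n by rewrite preL.
by have /submoduleP[_ Llin] := subL; rewrite -[f n]scale1r; apply: Llin.
Qed.

End Image.

Section ZhouRadical.
Variable R : pzRingType.
Implicit Types r x y : R.

Lemma zhou_radicalD x y :
  zhou_radical x -> zhou_radical y -> zhou_radical (x + y).
Proof.
move=> [n [N [u [Nu ->]]]] [m [K [v [Kv ->]]]].
exists (n + m)%N.
exists (fun i => match split i with inl j => N j | inr k => K k end).
exists (fun i => match split i with inl j => u j | inr k => v k end).
split=> [i|]; first (case: (split i) => j; [exact: Nu | exact: Kv]).
rewrite big_split_ord; congr (_ + _); apply: eq_bigr => i _.
  by rewrite (unsplitK (inl i)).
by rewrite (unsplitK (inr i)).
Qed.

(** Each delta-small [N i] is a right ideal, so the same family serves for the terms [u i * r]. *)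
Lemma zhou_radicalMr x r : zhou_radical x -> zhou_radical (x * r).
Proof.
move=> [n [N [u [Nu ->]]]]; exists n, N, (fun i => (r : R^c) *: u i).
split=> [i|]; last exact: scaler_sumr.
have [smallN Nui] := Nu i; split=> //.
by case: smallN => subN _; apply: (submodule_scale (r : R^c) subN Nui).
Qed.

(** A right ideal need not absorb [r] on the left, but left multiplication by [r] is an endomorphism
    of the right module R, so each [N i] is replaced by its delta-small image. *)
Lemma zhou_radicalMl r x : zhou_radical x -> zhou_radical (r * x).
Proof.
pose f (y : regular_module R) : regular_module R := r * (y : R).
have f_linear : linear f.
  by move=> s y z; rewrite /f !regular_moduleE mulrDr mulrA.
pose F := GRing.isLinear.Build _ _ _ _ f f_linear.
pose lf : {linear regular_module R -> regular_module R} := HB.pack f F.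
move=> [n [N [u [Nu ->]]]]; exists n, (fun i => lf @` N i), (fun i => lf (u i)).
split=> [i|]; last exact: (linear_sum lf).
have [smallN Nui] := Nu i.
by split; [apply: delta_small_image | exists (u i)].
Qed.

Lemma zhou_radicalB x y :
  zhou_radical x -> zhou_radical y -> zhou_radical (x - y).
Proof.
by move=> Dx Dy; rewrite -mulrN1; apply/zhou_radicalD/zhou_radicalMr.
Qed.

Lemma delta_clean_idempotent_mod x :
  delta_clean R -> zhou_radical (x * x - x).
Proof.
move=> /(_ x)[e [d [ee Dd ->]]].
(* As [e * e = e], the terms free of [d] cancel; each remaining term has [d] as a factor. *)
have -> : (e + d) * (e + d) - (e + d) = e * d + d * (e + d) - d.
  by rewrite mulrDl (mulrDr e) ee opprD addrA -(addrA e) (addrC e (_ + _)) addrK.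
apply: zhou_radicalB => //; apply: zhou_radicalD.
  exact: zhou_radicalMl.
exact: zhou_radicalMr.
Qed.

End ZhouRadical.

Theorem theorem2p22 (R : pzRingType) (hR : delta_clean R) : delta_reversible R.
Proof.
move=> a b ab0.
have idem x := delta_clean_idempotent_mod x hR.
have -> : b * a = (a + b) * (a + b) - (a + b) - (a * a - a) - (b * b - b).
  (* The linear terms cancel, leaving (a + b)^2 - (a^2 + b^2). *)
  rewrite -addrA -opprD addrACA -opprD opprB addrA subrK.
  by rewrite mulrDl !mulrDr ab0 addr0 addrCA addrK.
by do 2![apply: zhou_radicalB => //].
Qed.
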